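(* Let $(X,d_X)$ be a finite metric space with $|X|>1$, and define $D:=d_X(X\times X)$. Then $(X,d_X)$ admits a finite $\ell^\infty$-product factorization into finite $\ell^\infty$-prime metric spaces, i.e. $(X,d_X)\cong P_1\times_\infty\cdots\times_\infty P_m$ with each $P_i$ finite and $\ell^\infty$-prime. If there exists $r\in D$ such that the threshold relation $R_r^X$ is connected over $X$ and separating over $X$, then any two finite $\ell^\infty$-prime factorizations of $(X,d_X)$ have the same number of factors, and after reindexing corresponding factors are isometric.
   Context: All metric spaces are nonempty and all isometries are bijective; $\cong$ means isometric. $P_1\times_\infty\cdots\times_\infty P_m$ carries the max product metric $\max_j d_j(p_j,q_j)$. A metric space $X$ is $\ell^\infty$-prime if $|X|>1$ and every isometry $X\cong Y\times_\infty Z$ forces $|Y|=1$ or $|Z|=1$. A finite $\ell^\infty$-prime factorization is a decomposition into finitely many $\ell^\infty$-prime factors. For $r\geq0$, $R_r^X(x,y)\iff d_X(x,y)\leq r$. $R_r^X$ is connected over $X$ if for all distinct $x,y\in X$ there is a finite sequence $x=x_0,\dots,x_n=y$ with $R_r^X(x_i,x_{i+1})$ for all $0\le i<n$; it is separating over $X$ if for all distinct $x,y\in X$ there is $z\in X$ such that exactly one of $R_r^X(z,x)$, $R_r^X(z,y)$ holds. *)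

(* Defs.v *)
From HB Require Import structures.
From mathcomp Require Import all_boot all_order all_algebra.
From mathcomp Require Import all_classical all_reals all_analysis.

Set Implicit Arguments.
Unset Strict Implicit.
Unset Printing Implicit Defensive.

Import Order.TTheory GRing.Theory Num.Theory.

Local Open Scope classical_set_scope.
Local Open Scope card_scope.
Local Open Scope ring_scope.

(* A [metricType R] may be empty. Nonemptiness is never assumed separately:
   every space below is isometric to a space with at least two points or is
   a factor of a product isometric to one, hence is nonempty. *)

Definition isometry (R : realType) (X Y : metricType R) (f : X -> Y) : Prop :=
  bijective f /\ forall x y, mdist (f x) (f y) = mdist x y.

Definition isometric (R : realType) (X Y : metricType R) : Prop :=
  exists f : X -> Y, isometry f.

(* The library's pseudometric on [Y * Z] has as balls the products of balls,
   i.e. it is the one of the max metric; the instance adds the distance. *)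
Section max_product2.
Context (R : realType) (Y Z : metricType R).

Definition max_dist2 (p q : Y * Z) : R :=
  Num.max (mdist p.1 q.1) (mdist p.2 q.2).

Let max_dist2_ge0 p q : 0 <= max_dist2 p q.
Proof. by rewrite le_max mdist_ge0. Qed.

Let max_dist2_positivity p q : max_dist2 p q = 0 -> p = q.
Proof.
case: p q => [y z] [y' z'] h.
have : max_dist2 (y, z) (y', z') <= 0 by rewrite h.
rewrite ge_max /= => /andP[h1 h2].
by congr pair; apply: mdist_positivity; apply/eqP;
  rewrite eq_le mdist_ge0 ?h1 ?h2.
Qed.

Let ball_max_dist2 (p : Y * Z) (d : R) :
  ball p d = [set q | max_dist2 p q < d].
Proof.
apply/seteqP; split => q /=.
  by move=> []; rewrite !ballEmdist /= gt_max => -> ->.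
by rewrite gt_max => /andP[h1 h2]; split; rewrite ballEmdist.
Qed.

HB.instance Definition _ := PseudoMetric_isMetric.Build R (Y * Z)%type
  max_dist2_ge0 max_dist2_positivity ball_max_dist2.

End max_product2.

Definition max_product (R : realType) (m : nat) (P : 'I_m -> metricType R) :
  Type := {dffun forall i : 'I_m, P i}.

(* For [m = 0] the product is a single point. *)
Section max_product.
Context (R : realType) (m : nat) (P : 'I_m -> metricType R).

HB.instance Definition _ := Choice.on (max_product P).

(* Distances are nonnegative, so the initial value 0 only matters if m = 0. *)
Definition max_dist (p q : max_product P) : R :=
  \big[Num.max/0]_(j < m) mdist (p j) (q j).

Let max_distxx p : max_dist p p = 0.
Proof.
rewrite /max_dist; elim/big_ind: _ => // [x y -> ->|i _].
  by rewrite maxxx.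
exact: mdistxx.
Qed.

Let max_dist_positivity p q : max_dist p q = 0 -> p = q.
Proof.
move=> h; apply/ffunP => i; apply: mdist_positivity.
by apply/eqP; rewrite eq_le mdist_ge0 andbT -h; apply: le_bigmax.
Qed.

Let max_dist_sym p q : max_dist p q = max_dist q p.
Proof. by apply: eq_bigr => i _; rewrite metric_sym. Qed.

Let max_dist_triangle q p s : max_dist p s <= max_dist p q + max_dist q s.
Proof.
apply: bigmax_le => [|i _].
  by rewrite addr_ge0 // /max_dist bigmax_ge_id.
apply: (le_trans (metric_triangle _ (q i) _)).
by apply: lerD; apply: le_bigmax.
Qed.

HB.instance Definition _ := isMetric.Build R (max_product P)
  max_distxx max_dist_positivity max_dist_sym max_dist_triangle.

End max_product.

Definition linf_prime (R : realType) (X : metricType R) : Prop :=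
  `I_2 #<= [set: X] /\
  forall Y Z : metricType R, isometric X (Y * Z)%type ->
    [set: Y] #= `I_1 \/ [set: Z] #= `I_1.

Definition linf_prime_factorization (R : realType) (X : metricType R)
    (m : nat) (P : 'I_m -> metricType R) : Prop :=
  (forall i, linf_prime (P i)) /\ isometric X (max_product P).

Definition distance_set (R : realType) (X : metricType R) : set R :=
  [set mdist p.1 p.2 | p in [set: X * X]].

Definition threshold (R : realType) (X : metricType R) (r : R) : rel X :=
  fun x y => mdist x y <= r.

Definition connected_over (X : Type) (e : rel X) : Prop :=
  forall x y : X, x <> y -> exists s : seq X, path e x s /\ last x s = y.

Definition separating_over (X : Type) (e : rel X) : Prop :=
  forall x y : X, x <> y -> exists z : X, e z x (+) e z y.

(* Main.v *)
Require Import Defs.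
From HB Require Import structures.
From mathcomp Require Import all_boot all_order all_algebra.
From mathcomp Require Import all_classical all_reals all_analysis.
From mathcomp Require Import lra.

(** Existence is by induction on the number of points: a space that is not
    prime splits into two factors with fewer points each, and the prime
    factorizations of the two are concatenated.

    Uniqueness rests on an additive metric hidden in the threshold relation
    [e := threshold r].  For two related points [x] and [y] put
      [w x y := ln (c x x) + ln (c y y) - 2 ln (c x y)],
    where [c x y] counts the points related to both [x] and [y].  In a max
    product [e] is the conjunction of the relations of the factors, so [c] is
    multiplicative and [w] is the sum of the weights in the factors
    ([weight_band]).  Since [e] is separating, [w x y > 0] for [x <> y].  Let
    [rho] be the path metric of the weight [w], which is finite because [e] is
    connected.  It satisfies [rho x y = rho x z + rho z y] whenever [z] agrees
    with each of [x] and [y] in complementary sets of coordinates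
    ([path_dist_band]); so every max decomposition of [X] is at the same time
    an l1 decomposition of one and the same metric [rho].  Now [rho] sees the
    layers of any factorization as convex sets, while a point [z] that mixes
    the coordinates of [x] and [y] with respect to any other factorization is
    [rho]-between [x] and [y].  Hence the layers of one factorization are
    closed under mixing coordinates of the other ([layer_convex]).

    Fix a base point [x0], and let [L i] and [M j] be the layers through [x0]
    of two prime factorizations; they are isometric to the factors.  By the
    closure property [M j] splits [L i] as a max product of [L i `&` M j] and
    the intersection of [L i] with the complementary layer
    ([prime_layer]).  As [L i] is prime and nontrivial, it lies in
    some [M j] ([prime_layer_sub]).  By symmetry [M j] lies in some [L i'];
    distinct layers of one factorization meet only in [x0], so [i' = i] and
    [L i = M j]. *)

Set Implicit Arguments.
Unset Strict Implicit.
Unset Printing Implicit Defensive.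

Import Order.TTheory GRing.Theory Num.Theory.

Local Open Scope classical_set_scope.
Local Open Scope card_scope.
Local Open Scope ring_scope.

(** * Decompositions as binary operations *)

(** The algebraic form of a splitting [T = A * B]: [f x y] has the
    [A]-coordinate of [x] and the [B]-coordinate of [y].  The equation
    [f x y = x] says that [x] and [y] have the same [B]-coordinate. *)
Record rectangular_band (T : Type) (f : T -> T -> T) : Prop := {
  bandxx : forall x, f x x = x;
  bandl : forall x y z, f (f x y) z = f x z;
  bandr : forall x y z, f x (f y z) = f x z }.

(** Exchanges the two factors of the splitting. *)
Definition swap_op (T : Type) (f : T -> T -> T) : T -> T -> T :=
  fun x y => f y x.

Lemma swap_band (T : Type) (f : T -> T -> T) :
  rectangular_band f -> rectangular_band (swap_op f).
Proof.
move=> [fxx fl fr]; split=> [x|x y z|x y z]; rewrite /swap_op.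
- exact: fxx.
- exact: fr.
- exact: fl.
Qed.

(** For a rectangular band this says that [e] is the conjunction of a relation
    on each of the two factors. *)
Definition preserves (T : Type) (e : rel T) (f : T -> T -> T) : Prop :=
  forall x x' y y', e x x' -> e y y' -> e (f x y) (f x' y').

(** * The additive path metric of a separating connected relation *)

Section path_metric.
Context (R : realType) (T : finType) (e : rel T).
Context (e_refl : reflexive e).
Context (e_connected : connected_over e).
Context (e_separating : separating_over e).

Definition common (x y : T) : nat := #|[set z | e z x && e z y]%SET|.

(** That is [ln (c x x * c y y / (c x y) ^ 2)] with [c := common], a measure of
    how far the neighbourhoods of [x] and [y] are from being equal.  The
    logarithm turns the multiplicativity of [c] into additivity. *)
Definition weight (x y : T) : R :=
  ln (common x x)%:R + ln (common y y)%:R - 2 * ln (common x y)%:R.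

Lemma common_gt0 x y : e x y -> (0 < common x y)%N.
Proof. by move=> exy; apply/card_gt0P; exists x; rewrite inE e_refl. Qed.

Lemma common_lel x y : (common x y <= common x x)%N.
Proof.
by apply/subset_leq_card/fintype.subsetP => z; rewrite !inE => /andP[-> _].
Qed.

Lemma common_ler x y : (common x y <= common y y)%N.
Proof.
by apply/subset_leq_card/fintype.subsetP => z; rewrite !inE => /andP[_ ->].
Qed.

Lemma ln_common_le x y u v : (0 < common x y)%N ->
  (common x y <= common u v)%N ->
  ln (common x y)%:R <= ln (common u v)%:R :> R.
Proof.
move=> c0 cle; rewrite ler_ln ?posrE ?ltr0n ?ler_nat //.
exact: leq_trans cle.
Qed.

Lemma weight_ge0 x y : e x y -> 0 <= weight x y.
Proof.
move=> /common_gt0 c0.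
have := ln_common_le c0 (common_lel x y).
have := ln_common_le c0 (common_ler x y).
by rewrite /weight; lra.
Qed.

(** If the weight vanishes, then [x] and [y] have as many common neighbours as
    each has neighbours, hence the same neighbours, against separation. *)
Lemma weight_gt0 x y : e x y -> x <> y -> 0 < weight x y.
Proof.
move=> exy neq; rewrite lt_neqAle weight_ge0 // andbT; apply/eqP => w0.
have c0 := common_gt0 exy.
have lex := ln_common_le c0 (common_lel x y).
have ley := ln_common_le c0 (common_ler x y).
have pos u : ((common u u)%:R : R) \is Num.pos.
  by rewrite posrE ltr0n common_gt0.
have cpos : ((common x y)%:R : R) \is Num.pos by rewrite posrE ltr0n.
have eqx : common x y = common x x.
  by apply/eqP; rewrite -(eqr_nat R); apply/eqP/ln_inj => //;
    move: w0; rewrite /weight; lra.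
have eqy : common x y = common y y.
  by apply/eqP; rewrite -(eqr_nat R); apply/eqP/ln_inj => //;
    move: w0; rewrite /weight; lra.
have [z] := e_separating neq.
have /setP/(_ z) : [set z | e z x && e z y]%SET = [set z | e z x && e z x]%SET.
  apply/eqP; rewrite eqEcard; apply/andP; split; last first.
    by rewrite -/(common x x) -eqx.
  by apply/fintype.subsetP => t; rewrite !inE => /andP[-> _].
have /setP/(_ z) : [set z | e z x && e z y]%SET = [set z | e z y && e z y]%SET.
  apply/eqP; rewrite eqEcard; apply/andP; split; last first.
    by rewrite -/(common y y) -eqy.
  by apply/fintype.subsetP => t; rewrite !inE => /andP[_ ->].
by rewrite !inE; case: (e z x); case: (e z y).
Qed.

Fixpoint cost (x : T) (s : seq T) : R :=
  if s is y :: s' then weight x y + cost y s' else 0.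

Lemma cost_cat x s1 s2 : cost x (s1 ++ s2) = cost x s1 + cost (last x s1) s2.
Proof. by elim: s1 x => [|y s IH] x /=; rewrite ?add0r // IH addrA. Qed.

Lemma cost_ge0 x s : path e x s -> 0 <= cost x s.
Proof.
by elim: s x => //= y s IH x /andP[exy /IH]; apply: addr_ge0; apply: weight_ge0.
Qed.

Definition path_costs (x y : T) : set R :=
  [set cost x s | s in [set s | path e x s /\ last x s = y]].

Definition path_dist (x y : T) : R := inf (path_costs x y).

Lemma path_dist_le x s : path e x s -> path_dist x (last x s) <= cost x s.
Proof.
move=> es; apply: ge_inf; last by exists s.
by exists 0 => _ [t [et _] <-]; apply: cost_ge0.
Qed.

Lemma le_path_dist x y b :
  (forall s, path e x s -> last x s = y -> b <= cost x s) -> b <= path_dist x y.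
Proof.
move=> lb; apply: lb_le_inf => [|_ [s [es sy] <-]]; last exact: lb.
have [<-|/eqP xy] := eqVneq x y; first by exists 0, [::].
by have [s es] := e_connected xy; exists (cost x s), s.
Qed.

Lemma path_dist_ge0 x y : 0 <= path_dist x y.
Proof. by apply: le_path_dist => s es _; apply: cost_ge0. Qed.

Lemma path_dist_triangle y x z :
  path_dist x z <= path_dist x y + path_dist y z.
Proof.
rewrite -lerBlDr; apply: le_path_dist => s es sy.
rewrite lerBlDr -lerBlDl; apply: le_path_dist => t et tz.
rewrite lerBlDl -[in cost y t]sy -cost_cat -tz -sy -last_cat.
by apply: path_dist_le; rewrite cat_path es sy.
Qed.

(** A path from [x] to [y <> x] contains a step between distinct points, and the
    finitely many weights of such steps have a positive minimum. *)
Lemma path_dist_eq0 x y : path_dist x y <= 0 -> x = y.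
Proof.
move=> d0; apply: contrapT => neq.
pose E := [pred p : T * T | e p.1 p.2 & p.1 != p.2].
pose d : R := \big[Num.min/1]_(p | E p) weight p.1 p.2.
have dgt0 : 0 < d.
  rewrite /d; elim/big_ind: _ => // [a b a0 b0|[u v] /= /andP[euv /eqP]].
    by rewrite lt_min a0.
  exact: weight_gt0.
suff: d <= path_dist x y by move=> /le_trans/(_ d0); rewrite leNgt dgt0.
apply: le_path_dist => s es sy; move: neq; rewrite -sy => {sy d0}.
elim: s x es => //= z s IH x /andP[exz es].
have [xz|xz _] := eqVneq x z.
  rewrite -xz in exz es * => neq.
  by rewrite (le_trans (IH x es neq)) // lerDr weight_ge0.
have Exz : E (x, z) by rewrite /= exz.
apply: (@le_trans _ _ (weight x z)); last by rewrite lerDl cost_ge0.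
exact: (bigmin_le_cond _ (fun p : T * T => weight p.1 p.2) Exz).
Qed.

Section band.
Context (f : T -> T -> T).
Context (f_band : rectangular_band f) (f_e : preserves e f).

(** With subscripts for the coordinates and [N(a,b)] for the set of common
    neighbours of [a] and [b] in a factor, both sides are
      [#N(xA,xA) * #N(pB,qB) * #N(pA,qA) * #N(yB,yB)];
    exchanging coordinates in pairs of points is a bijection between the two
    sets of pairs being counted. *)
Lemma common_band x y p q :
  (common (f x p) (f x q) * common (f p y) (f q y) =
   common p q * common (f x y) (f x y))%N.
Proof.
have [fxx fl fr] := f_band.
rewrite /common -!cardsX.
pose h (z : T * T) := (f z.2 z.1, f z.1 z.2).
have hK : involutive h by move=> [z z']; rewrite /h /= !fl !fr !fxx.
rewrite -(card_imset _ (inv_inj hK)); apply: eq_card => w.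
apply/imsetP/idP => [[[z z'] + ->]|]; last first.
  rewrite !inE -andbA => /and4P[w1p w1q w2 _].
  exists (h w); last by rewrite hK.
  rewrite !inE /=; apply/andP; split; apply/andP; split.
  - by move: (f_e w2 w1p); rewrite fl.
  - by move: (f_e w2 w1q); rewrite fl.
  - by move: (f_e w1p w2); rewrite fr.
  - by move: (f_e w1q w2); rewrite fr.
rewrite !inE /= -andbA => /and4P[zp zq z'p z'q].
apply/andP; split; apply/andP; split.
- by move: (f_e z'p zp); rewrite fl fr fxx.
- by move: (f_e z'q zq); rewrite fl fr fxx.
- by move: (f_e zp z'p); rewrite fl fr.
- by move: (f_e zp z'p); rewrite fl fr.
Qed.

(** The weight is the sum of the weights in the two factors: [f x] freezes the
    first coordinate, [f^~ y] the second. *)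
Lemma weight_band x y p q : e p q ->
  weight (f x p) (f x q) + weight (f p y) (f q y) = weight p q.
Proof.
move=> epq.
have pos u v : e u v -> ((common u v)%:R : R) \is Num.pos.
  by move=> euv; rewrite posrE ltr0n common_gt0.
have lnE a b : e a b ->
    ln (common (f x a) (f x b))%:R + ln (common (f a y) (f b y))%:R =
    ln (common a b)%:R + ln (common (f x y) (f x y))%:R :> R.
  move=> eab; rewrite -!lnM ?pos ?f_e //.
  by rewrite -!natrM common_band.
have := lnE p p (e_refl p); have := lnE q q (e_refl q); have := lnE p q epq.
by rewrite /weight; lra.
Qed.

(** A path from [x] to [y] projects to a path from [x] to [f x y] that moves
    only the second coordinate and to one from [f x y] to [y] that moves only
    the first, and the costs of the two projections add up to that of the path. *)
Lemma path_dist_band x y :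
  path_dist x (f x y) + path_dist (f x y) y <= path_dist x y.
Proof.
have [fxx fl fr] := f_band.
apply: le_path_dist => s es sy.
have costE z t : path e z t -> cost z t =
    cost (f x z) (map (f x) t) + cost (f z y) (map (f^~ y) t).
  elim: t z => [|p t IH] z /=; first by rewrite addr0.
  by move=> /andP[zp /IH ->]; rewrite -(weight_band x y zp) addrACA.
have /path_dist_le : path e (f x x) (map (f x) s).
  by rewrite (homo_path _ es) // => p q; apply: f_e.
have /path_dist_le : path e (f x y) (map (f^~ y) s).
  by rewrite (homo_path _ es) // => p q epq; apply: f_e.
rewrite !last_map sy (costE _ _ es) !fxx; lra.
Qed.

End band.

(** The point [w := g u v] lies on a geodesic from [u] to [v].  Its projection
    [w' := f w u] to the [f]-layer of [u] and [v] is on a geodesic from [u] to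
    [w] and on one from [w] to [v]; the detour through [w] therefore costs
    [rho w w' + rho w' w] more than the one through [w'], so [w = w']. *)
Lemma layer_convex f g : rectangular_band f -> preserves e f ->
  rectangular_band g -> preserves e g ->
  forall u v, f v u = v -> f (g u v) u = g u v.
Proof.
move=> fb fe gb ge u v fvu; have [fxx fl fr] := fb.
set w := g u v.
have fwv : f w v = f w u by rewrite -[in LHS]fvu fr.
apply: path_dist_eq0.
have H1 := path_dist_band gb ge u v; rewrite -/w in H1.
have H2 := path_dist_band fb fe w v; rewrite fwv in H2.
have sfe : preserves e (swap_op f) by move=> ? ? ? ? ? ?; apply: fe.
have H3 := path_dist_band (swap_band fb) sfe u w; rewrite /swap_op in H3.
have H4 := path_dist_triangle (f w u) u v.
have := path_dist_ge0 w (f w u); lra.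
Qed.

End path_metric.

(** * Small cardinals *)

Lemma card_ge2P (T : Type) : `I_2 #<= [set: T] <-> exists x y : T, x <> y.
Proof.
split=> [/card_leP[f]|[x [y neq]]].
  have mem k : (k < 2)%N -> k \in (`I_2 : set nat) by move=> ?; rewrite inE.
  exists (val (f (SigSub (mem 0%N isT)))), (val (f (SigSub (mem 1%N isT)))).
  by move=> /val_inj/inj => /(_ (mem_set I) (mem_set I)) /(congr1 val).
pose h k := if k is 0%N then x else y.
have hinj : {in (`I_2 : set nat) &, injective h}.
  move=> [|[|k]] [|[|l]]; rewrite !inE //= => _ _ E; by case: neq.
apply: (card_le_trans _ (subset_card_le (@subsetT _ (h @` `I_2)))).
by rewrite (card_le_eqr (inj_card_eq hinj)).
Qed.

Lemma card_eq1P (T : Type) : [set: T] #= `I_1 <-> exists x : T, forall y, y = x.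
Proof.
split=> [/card_set_bijP[f [ffun finj fsurj]]|[x xP]].
  have f0 y : f y = 0%N by have /= := ffun y I; case: (f y).
  have [x _ _] := fsurj 0%N isT.
  by exists x => y; apply: finj; rewrite ?inE // !f0.
suff -> : [set: T] = [set x] by exact: card_set1.
by apply/seteqP; split=> y //= _; apply: xP.
Qed.

Lemma card_ge2_neq1 (T : Type) : T -> ~ ([set: T] #= `I_1) -> `I_2 #<= [set: T].
Proof.
move=> x T1; apply/card_ge2P; apply: contrapT => nex; apply: T1.
apply/card_eq1P; exists x => y; apply: contrapT => yx.
by apply: nex; exists y, x.
Qed.

(** * Isometries and subspaces *)

Section isometries.
Context (R : realType).
Implicit Types X Y Z : metricType R.

Lemma surjective_isometry X Y (f : X -> Y) :
  (forall x y, mdist (f x) (f y) = mdist x y) ->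
  (forall y, exists x, f x = y) -> Defs.isometry f.
Proof.
move=> fd /choice[g gK]; split=> //; exists g => // x.
by apply: mdist_positivity; rewrite -fd gK mdistxx.
Qed.

Lemma isometric_sym X Y : isometric X Y -> isometric Y X.
Proof.
move=> [f [[g fK gK] fd]]; exists g; split; first by exists f.
by move=> x y; rewrite -fd !gK.
Qed.

Lemma isometric_trans X Y Z : isometric X Y -> isometric Y Z -> isometric X Z.
Proof.
move=> [f [fb fd]] [g [gb gd]]; exists (g \o f); split; first exact: bij_comp.
by move=> x y /=; rewrite gd fd.
Qed.

Lemma linf_prime_isometric X Y : isometric X Y -> linf_prime X -> linf_prime Y.
Proof.
move=> XY [X2 Xp]; split=> [|A B YAB].
  have [f [[g fK gK] _]] := XY.
  have /card_ge2P[x [y neq]] := X2.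
  by apply/card_ge2P; exists (f x), (f y) => /(can_inj fK).
by apply: Xp; apply: isometric_trans YAB.
Qed.

End isometries.

(** The condition is made boolean so that the type inherits a choice structure
    and equality of its points is equality in [X]. *)
Definition metric_subspace (R : realType) (X : metricType R) (A : set X) :
  Type := {x : X | `[< A x >]}.

Section metric_subspace.
Context (R : realType) (X : metricType R) (A : set X).

HB.instance Definition _ := Choice.on (metric_subspace A).

Definition subspace_dist (x y : metric_subspace A) : R := mdist (val x) (val y).

Let subspace_distxx x : subspace_dist x x = 0.
Proof. exact: mdistxx. Qed.

Let subspace_dist_positivity x y : subspace_dist x y = 0 -> x = y.
Proof. by move=> /mdist_positivity/val_inj. Qed.

Let subspace_dist_sym x y : subspace_dist x y = subspace_dist y x.
Proof. exact: metric_sym. Qed.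

Let subspace_dist_triangle y x z :
  subspace_dist x z <= subspace_dist x y + subspace_dist y z.
Proof. exact: metric_triangle. Qed.

HB.instance Definition _ := isMetric.Build R (metric_subspace A)
  subspace_distxx subspace_dist_positivity
  subspace_dist_sym subspace_dist_triangle.

Definition in_subspace (x : X) (Ax : A x) : metric_subspace A :=
  exist _ x (asboolT Ax).

Lemma metric_subspaceP (x : metric_subspace A) : A (val x).
Proof. by apply/asboolP; case: x. Qed.

End metric_subspace.

(** * Decompositions of metric spaces *)

(** For a rectangular band this says that the splitting is a max product, see
    [mdist_band]. *)
Definition nonexpansive (R : realType) (X : metricType R) (f : X -> X -> X) :=
  forall x x' y y',
    mdist (f x y) (f x' y') <= Num.max (mdist x x') (mdist y y').

Section bands.
Context (R : realType) (X : metricType R).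

Lemma mdist_band (f : X -> X -> X) z x y :
  rectangular_band f -> nonexpansive f ->
  mdist x y = Num.max (mdist (f x z) (f y z)) (mdist (f z x) (f z y)).
Proof.
move=> [fxx fl fr] fd; apply/eqP; rewrite eq_le; apply/andP; split.
  by have := fd (f x z) (f y z) (f z x) (f z y); rewrite !fl !fr !fxx.
have := fd x y z z; have := fd z z x y; rewrite mdistxx ge_max.
by rewrite (max_l (mdist_ge0 _ _)) (max_r (mdist_ge0 _ _)) => -> ->.
Qed.

(** A band under which [L] is closed splits [L] as the max product of the points
    of [L] that have the second coordinate of [x0] and those that have the first
    one; primality makes one of the two sets the singleton of [x0]. *)
Lemma prime_layer (L : set X) (x0 : X) (g : X -> X -> X) :
  linf_prime (metric_subspace L) -> L x0 ->
  rectangular_band g -> nonexpansive g ->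
  (forall u v, L u -> L v -> L (g u v)) ->
  (forall x, L x -> g x x0 = x0) \/ (forall x, L x -> g x x0 = x).
Proof.
move=> [_ Lp] Lx0 gb gd gL; have [gxx gl gr] := gb.
pose E := [set x | L x /\ g x x0 = x].
pose F := [set x | L x /\ g x0 x = x].
have toE (x : metric_subspace L) : E (g (val x) x0).
  by split; [apply: gL => //; apply: metric_subspaceP|rewrite gl].
have toF (x : metric_subspace L) : F (g x0 (val x)).
  by split; [apply: gL => //; apply: metric_subspaceP|rewrite gr].
pose h (x : metric_subspace L) : (metric_subspace E * metric_subspace F)%type :=
  (in_subspace (toE x), in_subspace (toF x)).
have h_iso : isometric (metric_subspace L : metricType R)
    (metric_subspace E * metric_subspace F : metricType R)%type.
  exists h; apply: surjective_isometry => [x y|[a b]].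
    by rewrite [RHS](mdist_band x0 _ _ gb gd).
  have [La ga] := metric_subspaceP a; have [Lb gb'] := metric_subspaceP b.
  exists (in_subspace (gL _ _ La Lb)); congr pair; apply: val_inj => /=.
  - by rewrite gl.
  - by rewrite gr.
have [/card_eq1P[a aP]|/card_eq1P[b bP]] := Lp _ _ h_iso; [left|right] => x Lx.
- have Ex : E (g x x0) := toE (in_subspace Lx).
  have Ex0 : E x0 by [].
  have := congr1 val (aP (in_subspace Ex)).
  by rewrite -(aP (in_subspace Ex0)) /= => ->.
- have Fx : F (g x0 x) := toF (in_subspace Lx).
  have Fx0 : F x0 by [].
  have := congr1 val (bP (in_subspace Fx)).
  rewrite -(bP (in_subspace Fx0)) /= => gE.
  by rewrite -gE gr gxx.
Qed.

(** [layer_convex] for the relation [threshold r], which every nonexpansive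
    operation preserves. *)
Lemma metric_layer_convex (r : R) (f g : X -> X -> X) :
  finite_set [set: X] -> 0 <= r ->
  connected_over (threshold (X := X) r) ->
  separating_over (threshold (X := X) r) ->
  rectangular_band f -> nonexpansive f ->
  rectangular_band g -> nonexpansive g ->
  forall u v, f v u = v -> f (g u v) u = g u v.
Proof.
move=> Xfin r0 conn sep fb fd gb gd.
have [s sE] : exists s : seq X, forall x, x \in s.
  have [s sE] := (finite_seqP _).1 Xfin.
  by exists s => x; have : [set: X] x by []; rewrite sE.
have indexK : pcancel (index^~ s) (fun k => ohead (drop k s)).
  by move=> x; rewrite drop_index.
have enumP : Finite.axiom (undup s).
  by move=> x; rewrite count_uniq_mem ?undup_uniq // mem_undup sE.
pose fX : finType :=
  HB.pack (X : Type) (X : choiceType) (PCanIsCountable indexK)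
    (fintype.isFinite.Build X enumP).
have pres h : nonexpansive h -> preserves (threshold (X := X) r) h.
  move=> hd x x' y y' exx' eyy'; apply: le_trans (hd _ _ _ _) _.
  by rewrite ge_max; apply/andP.
apply: (@layer_convex R fX (threshold (X := X) r)) => //.
- by move=> x; rewrite /threshold mdistxx.
- exact: pres.
- exact: pres.
Qed.

End bands.

(** * Layers of a factorization *)

Section coordinates.
Context (R : realType) (X : metricType R).
Context (m : nat) (P : 'I_m -> metricType R) (phi : X -> max_product P).
Context (phi_iso : Defs.isometry phi).

Lemma mdist_coord i x y : mdist (phi x i) (phi y i) <= mdist x y.
Proof.
rewrite -(phi_iso.2 x y).
exact: (le_bigmax _ (fun j => mdist (phi x j) (phi y j))).
Qed.

Lemma coord_inj x y : (forall k, phi x k = phi y k) -> x = y.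
Proof. by move=> h; apply: (bij_inj phi_iso.1); apply/ffunP. Qed.

Lemma mdist_le_coord x y b : 0 <= b ->
  (forall k, mdist (phi x k) (phi y k) <= b) -> mdist x y <= b.
Proof. by move=> b0 h; rewrite -(phi_iso.2 x y); apply: bigmax_le. Qed.

Lemma coord_surj (p : forall k, P k) : exists x, forall k, phi x k = p k.
Proof.
have [[psi _ psiK] _] := phi_iso.
by exists (psi (finfun p)) => k; rewrite psiK ffunE.
Qed.

Lemma mix_exists i : exists f : X -> X -> X,
  forall x y k, phi (f x y) k = if k == i then phi x k else phi y k.
Proof.
have H (x : X) : exists g : X -> X,
    forall y k, phi (g y) k = if k == i then phi x k else phi y k.
  have [g gE] := choice (fun y =>
    coord_surj (fun k => if k == i then phi x k else phi y k)).
  by exists g.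
by have [f fE] := choice H; exists f.
Qed.

(** Coordinate [i] comes from the first argument, the others from the second:
    the band of the splitting of [X] into its [i]-th factor and the product of
    the others. *)
Definition mix i : X -> X -> X := sval (cid (mix_exists i)).

Lemma mixE i x y k : phi (mix i x y) k = if k == i then phi x k else phi y k.
Proof. exact: svalP (cid (mix_exists i)) x y k. Qed.

Lemma mix_band i : rectangular_band (mix i).
Proof.
by split=> *; apply: coord_inj => k; rewrite !mixE; case: (k == i).
Qed.

Lemma mix_nonexpansive i : nonexpansive (mix i).
Proof.
move=> x x' y y'; apply: mdist_le_coord => [|k].
  by rewrite le_max mdist_ge0.
by rewrite !mixE le_max; case: ifP => _; rewrite mdist_coord ?orbT.
Qed.

Definition layer (x0 : X) i : set X := [set x | mix i x x0 = x].

Lemma layerP x0 i x : layer x0 i x <-> forall k, k != i -> phi x k = phi x0 k.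
Proof.
split=> [<- k /negPf ki|h]; first by rewrite mixE ki.
by apply: coord_inj => k; rewrite mixE; case: eqVneq => // /h.
Qed.

Lemma layer_base x0 i : layer x0 i x0.
Proof. exact/layerP. Qed.

Lemma layer_isometric x0 i : isometric (metric_subspace (layer x0 i)) (P i).
Proof.
exists (fun x : metric_subspace (layer x0 i) => phi (val x) i).
apply: surjective_isometry => [x y|p].
  apply/eqP; rewrite eq_le mdist_coord /=; apply: mdist_le_coord => [|k].
    exact: mdist_ge0.
  have /layerP xP := metric_subspaceP x; have /layerP yP := metric_subspaceP y.
  by have [->//|ki] := eqVneq k i; rewrite xP // yP // mdistxx mdist_ge0.
have [x xE] := coord_surj (eqtype.dfwith (phi x0) p).
have Lx : layer x0 i x by apply/layerP => k ki; rewrite xE dfwith_out // eq_sym.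
by exists (in_subspace Lx); rewrite /= xE dfwith_in.
Qed.

Lemma layer_disjoint x0 i j x :
  i != j -> layer x0 i x -> layer x0 j x -> x = x0.
Proof.
move=> ij /layerP xi /layerP xj; apply: coord_inj => k.
by have [->|/xi//] := eqVneq k i; apply: xj.
Qed.

End coordinates.

(** * Uniqueness of prime factorizations *)

Section uniqueness.
Context (R : realType) (X : metricType R) (r : R).
Context (Xfin : finite_set [set: X]) (r_ge0 : 0 <= r).
Context (conn : connected_over (threshold (X := X) r)).
Context (sep : separating_over (threshold (X := X) r)).

Lemma prime_layer_nontrivial (m : nat) (P : 'I_m -> metricType R)
    (phi : X -> max_product P) (phi_iso : Defs.isometry phi) x0 i :
  linf_prime (P i) -> exists2 x, layer phi_iso x0 i x & x <> x0.
Proof.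
move=> Pi_prime.
have [/card_ge2P[a [b ab]] _] :
    linf_prime (metric_subspace (layer phi_iso x0 i)).
  exact: linf_prime_isometric (isometric_sym (layer_isometric _ _ _)) Pi_prime.
have [ax|] := pselect (val a = x0); last first.
  by exists (val a) => //; apply: metric_subspaceP.
exists (val b); first exact: metric_subspaceP.
by move=> bx; apply: ab; apply: val_inj; rewrite ax bx.
Qed.

(** The layer is closed under the mixing operations of the other factorization,
    so each of these either collapses it to [x0] or fixes it pointwise.  It
    cannot be collapsed by all of them, because its points would then agree with
    [x0] in all coordinates. *)
Lemma prime_layer_sub (m n : nat) (P : 'I_m -> metricType R)
    (Q : 'I_n -> metricType R) (phi : X -> max_product P)
    (chi : X -> max_product Q)
    (phi_iso : Defs.isometry phi) (chi_iso : Defs.isometry chi) x0 i :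
  linf_prime (P i) ->
  exists j, layer phi_iso x0 i `<=` layer chi_iso x0 j.
Proof.
move=> Pi_prime; apply: contrapT => noj.
have L_prime : linf_prime (metric_subspace (layer phi_iso x0 i)).
  exact: linf_prime_isometric (isometric_sym (layer_isometric _ _ _)) Pi_prime.
have closed j u v : layer phi_iso x0 i u -> layer phi_iso x0 i v ->
    layer phi_iso x0 i (mix chi_iso j u v).
  move=> Lu Lv; have [_ _ fr] := mix_band phi_iso i.
  have Eu : mix phi_iso i u x0 = u := Lu.
  have fvu : mix phi_iso i v u = v by rewrite -Eu fr.
  have conv := metric_layer_convex Xfin r_ge0 conn sep (mix_band phi_iso i)
    (mix_nonexpansive phi_iso i) (mix_band chi_iso j)
    (mix_nonexpansive chi_iso j) fvu.
  by rewrite /layer /= -(fr _ u x0) Eu conv.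
have triv j x : layer phi_iso x0 i x -> mix chi_iso j x x0 = x0.
  move: x; have [//|sub] := prime_layer L_prime (layer_base _ _ _)
    (mix_band chi_iso j) (mix_nonexpansive chi_iso j) (closed j).
  by case: noj; exists j.
have [x Lx] := prime_layer_nontrivial phi_iso x0 Pi_prime; apply.
apply: (coord_inj chi_iso) => k.
by rewrite -[in RHS](triv k x Lx) mixE eqxx.
Qed.

Lemma prime_factors_unique (m n : nat) (P : 'I_m -> metricType R)
    (Q : 'I_n -> metricType R) :
  linf_prime_factorization X P -> linf_prime_factorization X Q -> X ->
  m = n /\
  exists s : 'I_m -> 'I_n, bijective s /\ forall i, isometric (P i) (Q (s i)).
Proof.
move=> [Pp [phi phi_iso]] [Qp [chi chi_iso]] x0.
have /choice[s sP] : forall i, exists j,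
    layer phi_iso x0 i `<=` layer chi_iso x0 j.
  by move=> i; apply: prime_layer_sub.
have /choice[t tP] : forall j, exists i,
    layer chi_iso x0 j `<=` layer phi_iso x0 i.
  by move=> j; apply: prime_layer_sub.
have sK : cancel s t.
  move=> i; apply/eqP/negPn/negP => neq.
  have [x Lx] := prime_layer_nontrivial phi_iso x0 (Pp i); apply.
  exact: (layer_disjoint neq (tP _ _ (sP _ _ Lx)) Lx).
have tK : cancel t s.
  move=> j; apply/eqP/negPn/negP => neq.
  have [x Lx] := prime_layer_nontrivial chi_iso x0 (Qp j); apply.
  exact: (layer_disjoint neq (sP _ _ (tP _ _ Lx)) Lx).
have s_bij : bijective s by exists t.
split; first by have := bij_eq_card s_bij; rewrite !card_ord.
exists s; split=> // i.
have E : layer phi_iso x0 i = layer chi_iso x0 (s i).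
  by apply/seteqP; split; [exact: sP|rewrite -{2}(sK i); exact: tP].
apply: isometric_trans (isometric_sym (layer_isometric phi_iso x0 i)) _.
by rewrite E; apply: layer_isometric.
Qed.

End uniqueness.

(** * Existence of prime factorizations *)

Section existence.
Context (R : realType).

Definition family_cat (m n : nat) (P : 'I_m -> metricType R)
    (Q : 'I_n -> metricType R) (s : 'I_m + 'I_n) : metricType R :=
  match s with inl j => P j | inr k => Q k end.

(** The two bounds characterize the maximum, without unfolding it as an iterated
    operation. *)
Lemma isometric_max_product (X : metricType R) m (P : 'I_m -> metricType R)
    (pi : forall i, X -> P i) :
  (forall i x y, mdist (pi i x) (pi i y) <= mdist x y) ->
  (forall x y b, 0 <= b -> (forall i, mdist (pi i x) (pi i y) <= b) ->
    mdist x y <= b) ->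
  (forall p : forall i, P i, exists x, forall i, pi i x = p i) ->
  isometric X (max_product P).
Proof.
move=> pi_le le_pi pi_surj.
pose h (x : X) : max_product P := finfun (fun i => pi i x).
exists h; apply: surjective_isometry => [x y|p].
  apply/eqP; rewrite eq_le; apply/andP; split.
    by apply: bigmax_le => [|i _]; rewrite ?mdist_ge0 // !ffunE.
  apply: le_pi => [|i]; first exact: mdist_ge0.
  have := le_bigmax 0 (fun j => mdist (h x j) (h y j)) i.
  by rewrite /h !ffunE.
by have [x xE] := pi_surj p; exists x; apply/ffunP => i; rewrite ffunE.
Qed.

(** The value at [t] is [p (u t)] cast along [s (u t) = t]; at [t = s i] the cast
    is along a loop, hence trivial because [S] has decidable equality. *)
Lemma dependent_precomp_surj (I S : eqType) (F : S -> Type) (s : I -> S)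
    (u : S -> I) :
  cancel s u -> cancel u s -> forall p : (forall i, F (s i)),
  exists q : forall t, F t, forall i, q (s i) = p i.
Proof.
move=> sK uK p.
exists (fun t => eq_rect _ F (p (u t)) _ (uK t)) => i.
move: (uK (s i)); rewrite sK => E.
by rewrite (eq_irrelevance E (erefl _)).
Qed.

Lemma isometric_product_cat (X Y Z : metricType R) (m n : nat)
    (P : 'I_m -> metricType R) (Q : 'I_n -> metricType R) :
  isometric X (Y * Z)%type ->
  isometric Y (max_product P) -> isometric Z (max_product Q) ->
  isometric X (max_product
    (fun i : 'I_(m + n) => family_cat P Q (fintype.split i))).
Proof.
move=> [h [[h' hK h'K] hd]] [f fi] [g gi].
pose pi t x : family_cat P Q t := match t with
  | inl j => f (h x).1 j | inr k => g (h x).2 k end.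
apply: (isometric_max_product (pi := fun i => pi (fintype.split i)))
    => [i x y|x y b b0 le_b|p].
- rewrite -(hd x y) [leRHS]/(Num.max _ _) le_max.
  by case: (fintype.split i) => k; rewrite /pi mdist_coord ?orbT.
- rewrite -(hd x y) [leLHS]/(Num.max _ _) ge_max; apply/andP; split.
    apply: (mdist_le_coord fi) => // k.
    by have := le_b (lshift n k); rewrite (unsplitK (inl k)).
  apply: (mdist_le_coord gi) => // k.
  by have := le_b (rshift m k); rewrite (unsplitK (inr k)).
have [q qE] := dependent_precomp_surj (F := family_cat P Q) (@splitK m n)
  (@unsplitK m n) p.
have [y yE] := coord_surj fi (fun j => q (inl j)).
have [z zE] := coord_surj gi (fun k => q (inr k)).
exists (h' (y, z)) => i; rewrite -qE.
by case: (fintype.split i) => k; rewrite /pi h'K /= ?yE ?zE.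
Qed.

Lemma isometric_prodC (Y Z : metricType R) :
  isometric (Y * Z)%type (Z * Y)%type.
Proof.
exists (fun p => (p.2, p.1)); split=> [|p q]; last exact: maxC.
by exists (fun p => (p.2, p.1)) => -[].
Qed.

(** A factor of a nontrivial splitting embeds in [X] as a proper subset, the
    fibre of the other projection over one point; so it has fewer points. *)
Lemma factor_enumeration (X Y Z : metricType R) (s : seq X) :
  isometric X (Y * Z)%type -> `I_2 #<= [set: Z] -> Y -> (forall x, x \in s) ->
  exists2 t : seq Y, (size t < size s)%N & forall y, y \in t.
Proof.
move=> [h [[h' hK h'K] hd]] /card_ge2P[z0 [z1 z01]] y0 sX.
exists [seq (h x).1 | x <- s & (h x).2 == z0].
  rewrite size_map size_filter ltn_neqAle count_size andbT -all_count.
  by apply/allPn; exists (h' (y0, z1)) => //; rewrite h'K; apply/eqP => /esym.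
move=> y; apply/mapP; exists (h' (y, z0)); last by rewrite h'K.
by rewrite mem_filter sX h'K eqxx.
Qed.

Lemma prime_factorization_exists (N : nat) (X : metricType R) (s : seq X) :
  (size s <= N)%N -> (forall x, x \in s) -> `I_2 #<= [set: X] ->
  exists (m : nat) (P : 'I_m -> metricType R),
    (forall i, finite_set [set: P i]) /\ linf_prime_factorization X P.
Proof.
elim: N X s => [|N IH] X s sN sX X2.
  have /card_ge2P[x _] := X2.
  by move: (sX x); move: sN; rewrite leqn0 => /nilP ->.
have [Xp|Xnp] := pselect (linf_prime X).
  exists 1%N, (fun=> X); split=> [_|].
    by apply/finite_seqP; exists s; apply/seteqP; split=> x //= _; apply: sX.
  split=> //; apply: (isometric_max_product (pi := fun=> id)) => [//|x y b _|p].
    by apply; exact: ord0.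
  by exists (p ord0) => i; rewrite (ord1 i).
have [Y [Z [XYZ [Y2 Z2]]]] : exists Y Z : metricType R,
    isometric X (Y * Z)%type /\ (`I_2 #<= [set: Y] /\ `I_2 #<= [set: Z]).
  have [x _] := (card_ge2P _).1 X2.
  apply: contrapT => noYZ; apply: Xnp; split=> // Y Z XYZ.
  have [h _] := XYZ.
  apply: contrapT => /not_orP[Y1 Z1]; apply: noYZ; exists Y, Z; split=> //.
  by split; apply: card_ge2_neq1 => //; [exact: (h x).1|exact: (h x).2].
have /card_ge2P[y0 _] := Y2; have /card_ge2P[z0 _] := Z2.
have [t t_lt tY] := factor_enumeration XYZ Z2 y0 sX.
have XZY := isometric_trans XYZ (isometric_prodC Y Z).
have [u u_lt uZ] := factor_enumeration XZY Y2 z0 sX.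
have [m [P [Pfin [Pp YP]]]] := IH Y t (leq_trans t_lt sN) tY Y2.
have [n [Q [Qfin [Qp ZQ]]]] := IH Z u (leq_trans u_lt sN) uZ Z2.
exists (m + n)%N, (fun i => family_cat P Q (fintype.split i)); split=> [i|].
  by case: (fintype.split i).
split=> [i|]; first by case: (fintype.split i).
exact: isometric_product_cat XYZ YP ZQ.
Qed.

End existence.

Theorem theorem4p44 (R : realType) (X : metricType R)
    (Xfin : finite_set [set: X]) (Xgt1 : `I_2 #<= [set: X]) :
  (exists (m : nat) (P : 'I_m -> metricType R),
      (forall i, finite_set [set: P i]) /\ linf_prime_factorization X P) /\
  ((exists r : R, [/\ distance_set X r,
        connected_over (threshold (X := X) r) &
        separating_over (threshold (X := X) r)]) ->
   forall (m n : nat) (P : 'I_m -> metricType R) (Q : 'I_n -> metricType R),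
     linf_prime_factorization X P -> linf_prime_factorization X Q ->
     m = n /\
     exists s : 'I_m -> 'I_n,
       bijective s /\ forall i, isometric (P i) (Q (s i))).
Proof.
split.
  have [s sE] := (finite_seqP _).1 Xfin.
  apply: (prime_factorization_exists (leqnn (size s))) => // x.
  by have : [set: X] x by []; rewrite sE.
move=> [r [[[a b] _ <-] conn sep]] m n P Q PX QX.
exact: (prime_factors_unique Xfin (mdist_ge0 _ _) conn sep PX QX a).
Qed.
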